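(* Let $n$ be a positive integer which is not a prime power. Then $\diam(\mathcal{D}(\mathbb{Z}_n))=2$ if $n$ is a square-free number, and $\diam(\mathcal{D}(\mathbb{Z}_n))=3$ otherwise. In particular, $\mathcal{D}(\mathbb{Z}_n)$ is connected.
   Context: $\mathbb{Z}_n$ is the cyclic group of order $n$. The number $1=p^0$ is counted as a prime power. For a finite group $G$: the power graph $\mathcal{P}(G)$ is the simple graph with vertex set $G$ in which two distinct vertices are adjacent if one is a power of the other; the enhanced power graph $\mathcal{P}_E(G)$ is the simple graph with vertex set $G$ in which two distinct vertices $x,y$ are adjacent if $\langle x,y\rangle$ is cyclic; the difference graph $\mathcal{D}(G)$ is obtained from $\mathcal{P}_E(G)-\mathcal{P}(G)$ (vertex set $G$, edges those of $\mathcal{P}_E(G)$ that are not edges of $\mathcal{P}(G)$) by removing all isolated vertices. Here $\diam(\Gamma)$ denotes the diameter of a graph $\Gamma$, the greatest distance between two of its vertices. *)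

(* Defs.v *)
From mathcomp Require Import all_boot all_fingroup all_algebra all_solvable.

Set Implicit Arguments.
Unset Strict Implicit.
Unset Printing Implicit Defensive.

Record sgraph (T : finType) := SGraph {
  vertices : {set T};
  adj : rel T;
  adj_sym : symmetric adj;
  adj_irr : irreflexive adj;
  adj_vertices : forall x y, adj x y -> (x \in vertices) && (y \in vertices)
}.

Section Graphs.
Variables (T : finType) (X Y : sgraph T).

Definition is_walk (x : T) (p : seq T) (y : T) : bool :=
  path (adj X) x p && (last x p == y).

(* [size p] is the number of edges of the walk x :: p. *)
Definition is_dist (x y : T) (d : nat) : Prop :=
  (exists2 p, is_walk x p y & size p = d) /\
  (forall p, is_walk x p y -> d <= size p).

(* The distance between vertices in different components is infinite, so a
   graph with a finite diameter is connected. *)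
Definition is_diam (d : nat) : Prop :=
  (forall x y, x \in vertices X -> y \in vertices X ->
     exists2 k, is_dist x y k & k <= d) /\
  (exists x y, [/\ x \in vertices X, y \in vertices X & is_dist x y d]).

Definition connected_graph : Prop :=
  vertices X != set0 /\ {in vertices X &, forall x y, connect (adj X) x y}.

Definition minus_adj : rel T := [rel x y | adj X x y && ~~ adj Y x y].

Fact minus_adj_sym : symmetric minus_adj.
Proof. by move=> x y; rewrite /minus_adj /= !(adj_sym _ x). Qed.

Fact minus_adj_irr : irreflexive minus_adj.
Proof. by move=> x; rewrite /minus_adj /= adj_irr. Qed.

Fact minus_adj_vertices x y :
  minus_adj x y -> (x \in vertices X) && (y \in vertices X).
Proof. by case/andP => /adj_vertices. Qed.

Definition minus_graph : sgraph T :=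
  SGraph minus_adj_sym minus_adj_irr minus_adj_vertices.

Definition non_isolated : {set T} :=
  [set x in vertices X | [exists y, adj X x y]].

Fact non_isolated_vertices x y :
  adj X x y -> (x \in non_isolated) && (y \in non_isolated).
Proof.
move=> xy; have /andP[xX yX] := adj_vertices xy.
rewrite !inE xX yX /=; apply/andP.
by split; apply/existsP; [exists y | exists x; rewrite adj_sym].
Qed.

Definition remove_isolated : sgraph T :=
  SGraph (@adj_sym T X) (@adj_irr T X) non_isolated_vertices.

End Graphs.

Section GroupGraphs.
Variables (gT : finGroupType) (G : {group gT}).

(* [<[x]>] is the set of powers of x: see [power_adjP]. *)
Definition power_adj : rel gT :=
  [rel x y | [&& x \in G, y \in G, x != y & (x \in <[y]>%g) || (y \in <[x]>%g)]].

Fact power_adjP x y :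
  reflect [/\ x \in G, y \in G, x <> y &
             (exists k, x = y ^+ k)%g \/ (exists k, y = x ^+ k)%g]
          (power_adj x y).
Proof.
apply: (iffP and4P) => -[xG yG /eqP xy H]; split=> //; try exact/eqP.
  by case/orP: H => /cycleP; [left | right].
by case: H => /cycleP ->; rewrite ?orbT.
Qed.

Fact power_adj_sym : symmetric power_adj.
Proof. by move=> x y; rewrite /power_adj /= andbCA eq_sym orbC. Qed.

Fact power_adj_irr : irreflexive power_adj.
Proof. by move=> x; rewrite /power_adj /= eqxx !andbF. Qed.

Fact power_adj_vertices x y : power_adj x y -> (x \in G) && (y \in G).
Proof. by case/and4P=> -> ->. Qed.

Definition power_graph : sgraph gT :=
  SGraph power_adj_sym power_adj_irr power_adj_vertices.

Definition enhanced_adj : rel gT :=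
  [rel x y | [&& x \in G, y \in G, x != y & cyclic <<[set x; y]>>%g]].

Fact enhanced_adj_sym : symmetric enhanced_adj.
Proof. by move=> x y; rewrite /enhanced_adj /= andbCA eq_sym setUC. Qed.

Fact enhanced_adj_irr : irreflexive enhanced_adj.
Proof. by move=> x; rewrite /enhanced_adj /= eqxx !andbF. Qed.

Fact enhanced_adj_vertices x y : enhanced_adj x y -> (x \in G) && (y \in G).
Proof. by case/and4P=> -> ->. Qed.

Definition enhanced_power_graph : sgraph gT :=
  SGraph enhanced_adj_sym enhanced_adj_irr enhanced_adj_vertices.

Definition difference_graph : sgraph gT :=
  remove_isolated (minus_graph enhanced_power_graph power_graph).

End GroupGraphs.

(* k = 0 is allowed, so 1 is a prime power. *)
Definition prime_power (n : nat) : Prop :=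
  exists p k : nat, prime p /\ n = p ^ k.

Definition square_free (n : nat) : Prop :=
  forall d : nat, d ^ 2 %| n -> d = 1.

(* Main.v *)
(** In a cyclic group of order n, [x] is a power of [y] iff [#[x]] divides
    [#[y]], so [x] and [y] are adjacent in the difference graph iff their orders
    are incomparable divisors of n.  Let d | e be divisors of n, with d <> 1 and
    e <> n.  A divisor f is incomparable to both as soon as f does not divide e
    and d does not divide f.  If q is a prime divisor of n / e, the q-part of n
    does not divide e, so it is such an f unless d is a power of q.  Hence a common
    neighbour exists unless d and n / e are powers of the same prime p; then p^2
    divides n, and d, q, n_p, e is a path for any prime divisor q <> p of n.
    Conversely, if p^2 divides n, then d = p and e = n / p have no common
    neighbour.  Distance at least 2 is always attained, by [x] and [x^-1] for [x]
    of odd prime order. *)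
Require Import Defs.
From mathcomp Require Import all_boot all_fingroup all_algebra all_solvable.

Set Implicit Arguments.
Unset Strict Implicit.
Unset Printing Implicit Defensive.

(** * Incomparable divisors of an integer *)

Definition incomparable (d e : nat) : bool := ~~ (d %| e) && ~~ (e %| d).

Lemma incomparable_sym : symmetric incomparable.
Proof. by move=> d e; rewrite /incomparable andbC. Qed.

Lemma incomparable_between (d e f : nat) :
  d %| e -> ~~ (f %| e) -> ~~ (d %| f) -> incomparable d f && incomparable f e.
Proof.
move=> de fe df; rewrite /incomparable df fe /=; apply/andP; split.
  by apply: contra fe => /dvdn_trans; apply.
by apply: contra df; apply: dvdn_trans.
Qed.

Lemma part_ndvd (p e m : nat) :
  0 < e * m -> prime p -> p %| m -> ~~ ((e * m)`_p %| e).
Proof.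
rewrite muln_gt0 => /andP[e0 m0] pp pm.
rewrite p_part pfactor_dvdn // lognM // -ltnNge -[ltnLHS]addn0 ltn_add2l.
by rewrite -pfactor_dvdn // expn1.
Qed.

Lemma common_incomparable (n d e : nat) :
  0 < n -> d %| e -> e %| n -> d != 1 -> e != n ->
  (exists2 f, f %| n & incomparable d f && incomparable f e) \/
  (exists p i j, [/\ prime p, d = p ^ i.+1 & n = e * p ^ j.+1]).
Proof.
move=> n0 de /dvdnP[m def_n] d1 en; rewrite mulnC in def_n.
have m0 : 0 < m by move: n0; rewrite def_n muln_gt0 => /andP[].
have m1 : 1 < m.
  by rewrite ltn_neqAle m0 andbT; apply: contra en => /eqP m1;
    rewrite def_n -m1 muln1.
pose p := pdiv m; have pp : prime p := pdiv_prime m1.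
have good q : prime q -> q %| m -> ~~ (d %| n`_q) ->
    exists2 f, f %| n & incomparable d f && incomparable f e.
  move=> pq qm dq; exists (n`_q); first exact: dvdn_part.
  by apply: incomparable_between; rewrite // {1}def_n part_ndvd -?def_n.
(* Unless [d] is a power of [p], the prime [p] itself provides the common neighbour. *)
have [dp|] := boolP (d %| n`_p); last by left; apply: good (pdiv_dvd m) _.
have dn : p.-nat d by apply: pnat_dvd dp (part_pnat _ _).
have [mn|] := boolP (p.-nat m).
  have [[|i] di] := p_natP dn; first by rewrite di in d1.
  have [[|j] mj] := p_natP mn; first by rewrite mj in m1.
  by right; exists p, i, j; rewrite -mj.
(* A prime [q] other than [p] divides [m]; if [d] divided the [q]-part of [n], it would be a power
   of both primes, hence 1. *)
rewrite /pnat m0 => /allPn[q]; rewrite mem_primes => /and3P[pq _ qm] qp.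
left; apply: (good q) => //; apply: contra d1 => dq.
have dq' : q.-nat d by apply: pnat_dvd dq (part_pnat _ _).
by apply/eqP/(pnat_1 dn)/(pi_pnat dq').
Qed.

Lemma exists_other_prime (n p : nat) :
  0 < n -> ~ prime_power n -> prime p ->
  exists q, [/\ prime q, q %| n & q != p].
Proof.
move=> n0 npp pp; have [/p_natP[k nk]|] := boolP (p.-nat n).
  by case: npp; exists p, k.
rewrite /pnat n0 => /allPn[q]; rewrite mem_primes => /and3P[pq _ qn] qp.
by exists q.
Qed.

(** This is [common_incomparable] with [e = d]: its exceptional case would make [n] a power of
    [p]. *)
Lemma incomparable_exists (n d : nat) :
  0 < n -> ~ prime_power n -> d %| n -> d != 1 -> d != n ->
  exists2 f, f %| n & incomparable d f.
Proof.
move=> n0 npp dn d1 d_n.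
have [[f fn /andP[df _]]|[p [i [j [pp -> nE]]]]] :=
  common_incomparable n0 (dvdnn d) dn d1 d_n; first by exists f.
by case: npp; exists p, (i.+1 + j.+1); split; rewrite // expnD.
Qed.

Lemma incomparable_chain (n e p i j : nat) :
  ~ prime_power n -> 0 < n -> prime p -> n = e * p ^ j.+1 ->
  exists f g, [/\ f %| n, g %| n, incomparable (p ^ i.+1) f, incomparable f g
                & incomparable g e].
Proof.
move=> npp n0 pp nE; have [q [pq qn qp]] := exists_other_prime n0 npp pp.
have pj : p %| p ^ j.+1 by rewrite expnS dvdn_mulr.
have qpk k : 0 < k -> incomparable (p ^ k) q.
  case: k => // k _; apply/andP; split; last first.
    by apply: contra qp; rewrite Euclid_dvdX // dvdn_prime2 // => /andP[].
  apply: contra qp => H; have: p %| q by apply: dvdn_trans H; rewrite expnS dvdn_mulr.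
  by rewrite dvdn_prime2 // eq_sym.
exists q, n`_p; split; rewrite ?dvdn_part ?qpk //.
  rewrite incomparable_sym p_part qpk // logn_gt0 mem_primes pp n0 nE.
  exact: dvdn_mull.
(* If [e] divided the [p]-part of [n], then [e], and with it [n], would be a power of [p]. *)
rewrite /incomparable {1}nE part_ndvd -?nE //=; apply/negP => H.
have /p_natP[k ek] : p.-nat e by apply: pnat_dvd H (part_pnat _ _).
by case: npp; exists p, (k + j.+1); rewrite expnD -ek.
Qed.

Lemma square_freePn (n : nat) :
  0 < n -> ~ square_free n -> exists2 p, prime p & p ^ 2 %| n.
Proof.
(* Searching the finite list [primes n] is decidable, so the negated hypothesis yields an actual
   prime. *)
move=> n0 nsf; have [/hasP[p]|/hasPn H] := boolP (has (fun p => p ^ 2 %| n) (primes n)).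
  by rewrite mem_primes => /andP[pp _]; exists p.
case: nsf => d dn; apply/eqP; apply: contraT => d1.
have d0 : 0 < d by case: d dn {d1} => //; rewrite dvd0n => /eqP n_0; rewrite n_0 in n0.
have pp : prime (pdiv d) by apply: pdiv_prime; rewrite ltn_neqAle eq_sym d1.
have pd := pdiv_dvd d.
have p2 : pdiv d ^ 2 %| n by apply: dvdn_trans dn; rewrite dvdn_exp2r.
have := H (pdiv d); rewrite mem_primes pp n0 p2.
by apply; apply: dvdn_trans p2; rewrite dvdn_mulr.
Qed.

(** * Walks and distances in a graph *)

Section Distance.
Variables (T : finType) (X : sgraph T).

Lemma is_walk_nil (x y : T) : is_walk X x [::] y = (x == y).
Proof. by []. Qed.

Lemma is_walk_cons (x y z : T) (p : seq T) :
  is_walk X x (z :: p) y = adj X x z && is_walk X z p y.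
Proof. by rewrite /is_walk /= andbA. Qed.

Lemma is_walk_sym (x y : T) (p : seq T) :
  is_walk X x p y -> exists2 q, is_walk X y q x & size q = size p.
Proof.
case/andP=> xp /eqP<-; exists (rev (belast x p)); last by rewrite size_rev size_belast.
apply/andP; split; last by case: p {xp} => //= z p; rewrite rev_cons last_rcons.
rewrite rev_path; apply: sub_path xp => u v /=; by rewrite adj_sym.
Qed.

Lemma dist_le_walk (x y : T) (p : seq T) :
  is_walk X x p y -> exists2 k, is_dist X x y k & k <= size p.
Proof.
(* Walks of a fixed length form a finite type, so [P] is boolean and has a least witness. *)
move=> wp; pose P k := [exists t : k.-tuple T, is_walk X x t y].
have walkP q : is_walk X x q y -> P (size q).
  by move=> wq; apply/existsP; exists (in_tuple q).
have exP : exists k, P k by exists (size p); apply: walkP.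
case: (ex_minnP exP) => k /existsP[t wt] kmin.
exists k; last exact/kmin/walkP.
split; first by exists (tval t); rewrite ?size_tuple.
by move=> q wq; apply/kmin/walkP.
Qed.

Lemma is_diam_walks (d : nat) :
  (forall x y, x \in vertices X -> y \in vertices X ->
     exists2 p, is_walk X x p y & size p <= d) ->
  (exists x y, [/\ x \in vertices X, y \in vertices X &
     forall p, is_walk X x p y -> d <= size p]) ->
  is_diam X d.
Proof.
move=> ub [x [y [xX yX lb]]]; split=> [u v uX vX|].
  have [p wp pd] := ub u v uX vX; have [k uvk kp] := dist_le_walk wp.
  by exists k; rewrite ?(leq_trans kp).
exists x, y; split=> //; split=> //.
by have [p wp pd] := ub x y xX yX; exists p => //; apply/eqP; rewrite eqn_leq pd lb.
Qed.

End Distance.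

(** * The difference graph of a cyclic group, read off from element orders *)

Section CyclicDifferenceGraph.
Variables (gT : finGroupType) (G : {group gT}).
Hypothesis cycG : cyclic G.
Local Open Scope group_scope.

Lemma mem_cycle_order (x y : gT) :
  x \in G -> y \in G -> (x \in <[y]>) = (#[x] %| #[y])%N.
Proof.
by move=> xG yG; rewrite -cycle_subG !orderE (cardSg_cyclic cycG) ?cycle_subG.
Qed.

Lemma exists_order (d : nat) : (d %| #|G|)%N -> exists2 x, x \in G & #[x] = d.
Proof.
have [g defG] := cyclicP cycG; rewrite defG -orderE => dg.
exists (g ^+ (#[g] %/ d)); first exact: mem_cycle.
by rewrite orderXdiv ?dvdn_div // divnA // mulKn ?order_gt0.
Qed.

(** The enhanced power graph of a cyclic group is complete, so only non-adjacency in the power graph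
    matters; incomparable orders already force [x != y]. *)
Lemma difference_adjE (x y : gT) :
  adj (difference_graph G) x y =
  [&& x \in G, y \in G & incomparable #[x] #[y]].
Proof.
rewrite /= /minus_adj /= /enhanced_adj /power_adj /= /incomparable.
have [xG|] := boolP (x \in G) => //=.
have [yG|] := boolP (y \in G) => //=.
have -> : cyclic <<[set x; y]>>.
  by apply: cyclicS cycG; rewrite gen_subG subUset !sub1set xG.
rewrite !mem_cycle_order // andbT negb_and negb_or negbK.
by have [->|] := eqVneq x y; rewrite ?dvdnn.
Qed.

Lemma incomparable_adj (x y : gT) :
  x \in G -> y \in G -> incomparable #[x] #[y] ->
  adj (difference_graph G) x y.
Proof. by move=> xG yG xy; rewrite difference_adjE xG yG. Qed.

Hypothesis npp : ~ prime_power #|G|.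

(** The orders 1 and [#|G|] are comparable with every divisor of [#|G|]; every other divisor has an
    incomparable one. *)
Lemma difference_vertex (x : gT) :
  (x \in vertices (difference_graph G)) =
  [&& x \in G, #[x] != 1%N & #[x] != #|G|].
Proof.
apply/idP/and3P => [|[xG x1 xn]].
  rewrite inE => /andP[_ /existsP[y adj_xy]].
  have: adj (difference_graph G) x y by []; rewrite difference_adjE.
  case/and3P=> xG yG /andP[xy yx]; split=> //.
    by apply: contra xy => /eqP->.
  by apply: contra yx => /eqP->; apply: order_dvdG.
have [f fn xf] := incomparable_exists (cardG_gt0 G) npp (order_dvdG xG) x1 xn.
have [y yG yf] := exists_order fn.
have /adj_vertices/andP[] // : adj (difference_graph G) x y.
by apply: incomparable_adj; rewrite ?yf.
Qed.

Lemma short_walk (x y : gT) :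
    x \in vertices (difference_graph G) -> y \in vertices (difference_graph G) ->
    (#[x] %| #[y])%N ->
  (exists2 p, is_walk (difference_graph G) x p y & (size p <= 2)%N) \/
  ((exists2 p, is_walk (difference_graph G) x p y & (size p <= 3)%N) /\
   ~ square_free #|G|).
Proof.
rewrite !difference_vertex => /and3P[xG x1 xn] /and3P[yG y1 yn] xy.
have [[f fn /andP[xf fy]]|[p [i [j [pp xE nE]]]]] :=
    common_incomparable (cardG_gt0 G) xy (order_dvdG yG) x1 yn.
  have [z zG zf] := exists_order fn.
  by left; exists [:: z; y] => //;
    rewrite !is_walk_cons is_walk_nil eqxx !incomparable_adj ?zf.
right; split.
  have [f [g [fn gn]]] := incomparable_chain i npp (cardG_gt0 G) pp nE.
  rewrite -xE => xf fg gy.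
  have [z zG zf] := exists_order fn; have [t tG tg] := exists_order gn.
  by exists [:: z; t; y] => //;
    rewrite !is_walk_cons is_walk_nil eqxx !incomparable_adj ?zf ?tg.
(* [p] divides [#[x]], hence [#[y]], and also the cofactor [p ^ j.+1], so [p ^ 2] divides [#|G|]. *)
move=> /(_ p) H; have p1 := prime_gt1 pp.
rewrite H ?ltnn // in p1.
rewrite nE expnS expn1 dvdn_mul //; last by rewrite expnS dvdn_mulr.
by apply: dvdn_trans xy; rewrite xE expnS dvdn_mulr.
Qed.

Lemma difference_walk (x y : gT) :
    x \in vertices (difference_graph G) -> y \in vertices (difference_graph G) ->
  exists2 p, is_walk (difference_graph G) x p y &
    (size p <= 3)%N /\ (square_free #|G| -> (size p <= 2)%N).
Proof.
move=> xX yX.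
have cmp u v : u \in vertices (difference_graph G) ->
    v \in vertices (difference_graph G) -> (#[u] %| #[v])%N ->
  exists2 p, is_walk (difference_graph G) u p v &
    (size p <= 3)%N /\ (square_free #|G| -> (size p <= 2)%N).
  move=> uX vX uv; have [[p wp p2]|[[p wp p3] nsf]] := short_walk uX vX uv.
    by exists p => //; split=> //; apply: leq_trans p2 _.
  by exists p.
have [/cmp|xy] := boolP (#[x] %| #[y])%N; first exact.
have [yx|yx] := boolP (#[y] %| #[x])%N.
  have [p wp] := cmp y x yX xX yx.
  by have [q wq <-] := is_walk_sym wp; exists q.
move: xX yX; rewrite !difference_vertex => /and3P[xG _ _] /and3P[yG _ _].
exists [:: y] => //.
by rewrite is_walk_cons is_walk_nil eqxx incomparable_adj // /incomparable xy.
Qed.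

Lemma order_prime_vertex (p : nat) (x : gT) :
  x \in G -> prime p -> #[x] = p -> x \in vertices (difference_graph G).
Proof.
move=> xG pp xp; rewrite difference_vertex xG xp /=; apply/andP; split.
  by apply: contraTneq pp => ->.
by apply/eqP => pn; case: npp; exists p, 1%N; rewrite expn1.
Qed.

Lemma difference_dist2 :
  exists x y, [/\ x \in vertices (difference_graph G),
    y \in vertices (difference_graph G) &
    forall p, is_walk (difference_graph G) x p y -> (2 <= size p)%N].
Proof.
(* An odd [p] ensures that [x] and [x^-1] differ; their equal orders keep them non-adjacent. *)
have [//|p [pp pn p2]] := @exists_other_prime _ 2 (cardG_gt0 G) npp.
have [x xG xp] := exists_order pn.
have xX := order_prime_vertex xG pp xp.
have xVX : x^-1 \in vertices (difference_graph G).
  by apply: (@order_prime_vertex p); rewrite ?groupV ?orderV.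
exists x, x^-1; split=> // -[|y [|//]].
  rewrite is_walk_nil => /eqP xV; case/negP: p2; rewrite -dvdn_prime2 // -xp order_dvdn.
  by rewrite expgS expg1 {2}xV mulgV.
rewrite is_walk_cons is_walk_nil difference_adjE.
case/andP=> /and3P[_ _ /andP[xy _]] /eqP yV.
by rewrite yV orderV dvdnn in xy.
Qed.

Lemma difference_dist3 :
  ~ square_free #|G| ->
  exists x y, [/\ x \in vertices (difference_graph G),
    y \in vertices (difference_graph G) &
    forall p, is_walk (difference_graph G) x p y -> (3 <= size p)%N].
Proof.
case/(square_freePn (cardG_gt0 G)) => p pp /dvdnP[m nE].
have p0 := prime_gt0 pp; have p1 := prime_gt1 pp.
have mp0 : (0 < m * p)%N.
  by have := cardG_gt0 G; rewrite nE expnS expn1 mulnA muln_gt0 => /andP[].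
have nE' : #|G| = (m * p * p)%N by rewrite nE expnS expn1 mulnA.
have [x xG xp] : exists2 x, x \in G & #[x] = p.
  by apply: exists_order; rewrite nE' dvdn_mull.
have [y yG ym] : exists2 y, y \in G & #[y] = (m * p)%N.
  by apply: exists_order; rewrite nE' dvdn_mulr.
have xX := order_prime_vertex xG pp xp.
have yX : y \in vertices (difference_graph G).
  rewrite difference_vertex // yG ym nE' (ltn_eqF (ltn_Pmulr p1 mp0)) andbT.
  by rewrite muln_eq1 (gtn_eqF p1) andbF.
exists x, y; split=> // -[|z [|t [|//]]].
(* If [x = y], then [m * p = p] and [#|G|] is [p ^ 2]. *)
- rewrite is_walk_nil => /eqP xy; case: npp; exists p, 2; split=> //.
  by rewrite nE' -ym -xy xp.
- rewrite is_walk_cons is_walk_nil difference_adjE.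
  case/andP=> /and3P[_ _ /andP[xz _]] /eqP zy.
  by rewrite zy xp ym dvdn_mull in xz.
(* A middle vertex [z] has order prime to [p]; dividing [m * p * p], this order divides [m * p], the
   order of [y]. *)
rewrite !is_walk_cons is_walk_nil !difference_adjE.
case/and3P=> /and3P[_ zG /andP[xz _]] /and3P[_ _ /andP[zt _]] /eqP ty.
rewrite ty ym xp in xz zt; case/negP: zt.
rewrite -(@Gauss_dvdl _ _ p); last by rewrite coprime_sym prime_coprime.
by rewrite -nE' order_dvdG.
Qed.

Lemma difference_connected : connected_graph (difference_graph G).
Proof.
split=> [|x y xX yX].
  by have [x [_ [xX _ _]]] := difference_dist2; apply/set0Pn; exists x.
have [p /andP[xp /eqP py] _] := difference_walk xX yX.
by apply/connectP; exists p.
Qed.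

End CyclicDifferenceGraph.

(* [Zp n] is the additive group of the integers mod n, of order n for every
   n > 0. *)
Theorem theorem4p2 (n : nat) (n_gt0 : 0 < n) (n_npp : ~ prime_power n) :
  [/\ square_free n -> is_diam (difference_graph (Zp n)%G) 2,
      ~ square_free n -> is_diam (difference_graph (Zp n)%G) 3
    & connected_graph (difference_graph (Zp n)%G)].
Proof.
have cycZ : cyclic (Zp n).
  (* [Zp n] is all of ['Z_n] only for [1 < n]; for [n = 1] it is the trivial group, as ['Z_1] has
     two elements. *)
  rewrite /Zp; case: ifP => _; last exact: cyclic1.
  by apply/cyclicP; exists Zp1; apply: Zp_cycle.
have cardZ : #|Zp n| = n by apply: card_Zp.
have npp : ~ prime_power #|Zp n| by rewrite cardZ.
split=> [sf|nsf|]; last exact: difference_connected.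
  apply: is_diam_walks (difference_dist2 cycZ npp) => x y xX yX.
  have [p wp [_ p2]] := difference_walk cycZ npp xX yX.
  by exists p => //; apply: p2; rewrite cardZ.
apply: is_diam_walks => [x y xX yX|].
  by have [p wp [p3 _]] := difference_walk cycZ npp xX yX; exists p.
by apply: difference_dist3; rewrite ?cardZ.
Qed.
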